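(* Let $G\subsetneq E$ and $G'\subsetneq E'$ be proper domains in real Banach spaces $E$ and $E'$ of dimension at least two. Suppose that $G$ is a $c$-John domain and that $f:\overline G\to\overline{G'}$ is a homeomorphism that maps $G$ onto $G'$ and is $\eta$-quasisymmetric relative to $\delta G$. Then $G'$ is a diameter $c'$-John domain, where $c'=c'(c,\eta)$ depends only on $c$ and $\eta$.
   Context: A domain is an open connected set. The norm is written $|\cdot|$; $\delta G=\overline G\setminus G$ is the boundary of $G$, and $\delta_G(x)=\inf\{|x-y|:y\in\delta G\}$ for $x\in G$. A curve is a continuous map from a closed interval; it joins its endpoints. For points $u,v$ on a curve $\gamma$, $\gamma[u,v]$ is the part of $\gamma$ from $u$ to $v$, $l$ denotes length, and $\mathrm{diam}$ denotes diameter. For $c\ge 1$, a domain $G\subsetneq E$ is $c$-John (also called length $c$-John) if each pair of points $x_1,x_2\in G$ can be joined by a curve $\gamma$ in $G$ with $\min_{j=1,2} l(\gamma[x_j,x])\le c\,\delta_G(x)$ for all $x\in\gamma$. It is diameter $c$-John if the same holds with $l(\gamma[x_j,x])$ replaced by $\mathrm{diam}(\gamma[x_j,x])$. Quasisymmetry: a triple in a metric space $X$ is an ordered sequence $T=(x,y,z)$ of three distinct points, with ratio $\rho(T)=|y-x|/|z-x|$. For $A\subset X$, $T=(x,y,z)$ is a triple in the pair $(X,A)$ if $x\in A$ or $\{y,z\}\subset A$. Given a homeomorphism $\eta:[0,\infty)\to[0,\infty)$, an embedding $f:X\to Y$ of metric spaces is $\eta$-quasisymmetric relative to $A$ if $\rho(f(T))\le\eta(\rho(T))$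 for every triple $T$ in $(X,A)$, where $f(T)=(f(x),f(y),f(z))$. Here $X=\overline G$, $A=\delta G$. *)

(* Defs.v *)
From HB Require Import structures.
From mathcomp Require Import all_boot all_order all_algebra.
From mathcomp Require Import all_classical all_reals all_analysis.
Set Implicit Arguments.
Unset Strict Implicit.
Unset Printing Implicit Defensive.
Import Order.TTheory GRing.Theory Num.Theory.
Import numFieldNormedType.Exports.
Local Open Scope classical_set_scope.
Local Open Scope ring_scope.

(* A map between subsets is the restriction to [A] of a total function; its
   values off [A] play no role. *)
Definition homeomorphism_on (T U : topologicalType) (A : set T) (B : set U)
    (f : T -> U) : Prop :=
  [/\ set_bij A B f, {within A, continuous f} &
      exists2 g : U -> T, {within B, continuous g} & {in A, cancel f g}].

Definition dim_ge2 (R : realType) (E : normedModType R) : Prop :=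
  exists u v : E, forall a b : R, a *: u + b *: v = 0 -> a = 0 /\ b = 0.

Definition proper_domain (R : realType) (E : normedModType R) (G : set E) :
    Prop :=
  [/\ open G, connected G & G `<` [set: E]].

(* The topological boundary when [G] is open. *)
Definition bdry (T : topologicalType) (G : set T) : set T := closure G `\` G.

Definition dist_bdry (R : realType) (E : normedModType R) (G : set E) (x : E) :
    \bar R :=
  ereal_inf [set `|x - y|%:E | y in bdry G].

Definition diam (R : realType) (E : normedModType R) (A : set E) : \bar R :=
  ereal_sup [set `|p.1 - p.2|%:E | p in A `*` A].

(* The supremum of the lengths of inscribed polygons, as [total_variation] in
   realfun.v, which is restricted to real-valued functions.  The partitions in
   [itv_partition s t] omit the first point [s]. *)
Definition arc_length (R : realType) (E : normedModType R) (g : R -> E)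
    (s t : R) : \bar R :=
  ereal_sup [set (\sum_(0 <= i < size r)
      `|g (nth t (s :: r) i.+1) - g (nth t (s :: r) i)|)%:E
    | r in itv_partition s t].

Definition arc_diam (R : realType) (E : normedModType R) (g : R -> E)
    (s t : R) : \bar R :=
  diam (g @` `[s, t]).

(* The points of the curve [g] on [[a, b]] are taken together with their
   parameter, so that the subcurves are defined even if [g] is not injective.
   [size_of g s t] measures the part of [g] with parameters in [[s, t]]. *)
Definition john_with (R : realType) (E : normedModType R)
    (size_of : (R -> E) -> R -> R -> \bar R) (c : R) (G : set E) : Prop :=
  forall x1 x2 : E, G x1 -> G x2 ->
  exists (a b : R) (g : R -> E),
    [/\ a <= b, {within `[a, b], continuous g}, g @` `[a, b] `<=` G,
        g a = x1 /\ g b = x2 &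
        forall t, t \in `[a, b] ->
          (Order.min (size_of g a t) (size_of g t b)
             <= c%:E * dist_bdry G (g t))%E].

Definition length_john (R : realType) (E : normedModType R) (c : R)
    (G : set E) : Prop :=
  john_with (@arc_length R E) c G.

Definition diameter_john (R : realType) (E : normedModType R) (c : R)
    (G : set E) : Prop :=
  john_with (@arc_diam R E) c G.

Definition ratio (R : realType) (E : normedModType R) (x y z : E) : R :=
  `|y - x| / `|z - x|.

Definition triple_in_pair (T : Type) (X A : set T) (x y z : T) : Prop :=
  [/\ [/\ X x, X y & X z], [/\ x <> y, y <> z & z <> x] &
      A x \/ (A y /\ A z)].

(* Meant for [f] an embedding of [X] and [A `<=` X]. *)
Definition quasisymmetric_rel (R : realType) (E E' : normedModType R)
    (eta : R -> R) (X A : set E) (f : E -> E') : Prop :=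
  forall x y z : E, triple_in_pair X A x y z ->
    ratio (f x) (f y) (f z) <= eta (ratio x y z).

(* Main.v *)
Require Import Defs.
From mathcomp Require Import all_boot all_order all_algebra.
From mathcomp Require Import all_classical all_reals all_analysis.
From mathcomp Require Import lra.
Import Order.TTheory GRing.Theory Num.Theory.
Import numFieldNormedType.Exports.
Local Open Scope classical_set_scope.
Local Open Scope ring_scope.

(** Three-point control relative to the boundary makes the theorem short.  Let
    [y] be a point of a John curve whose subcurve from an endpoint to [y] has
    size at most [c] times the distance of [y] to the boundary.  For a boundary
    point [w] and a point [z] of that subcurve, [|z - y| <= c |y - w|], hence
    [|z - w| <= (c + 1) |y - w|].  The triple [(w, z, y)] has its first point
    on the boundary, so quasisymmetry gives [|fz - fw| <= M |fy - fw|] with [M]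
    the maximum of [eta] on the compact interval [[0, c + 1]], and therefore
    [|fz - fy| <= (1 + M) |fy - fw|] ([quasisymmetric_rel_dist]).  As [f] maps
    the boundary onto the boundary, [fw] is an arbitrary boundary point of the
    image domain: the image of the subcurve has diameter at most [2 (1 + M)]
    times the distance of [fy] to the boundary, and the image of the John curve
    is the required curve ([diameter_john_quasisymmetric]).

    The argument uses diameters only; a length John domain is a diameter John
    domain because a chord of a curve is no longer than the curve
    ([arc_diam_le_length]). *)

Lemma within_continuous_comp_sub (T U V : topologicalType) (A : set T)
    (B : set U) (g : T -> U) (f : U -> V) :
  g @` A `<=` B -> {within A, continuous g} -> {within B, continuous f} ->
  {within A, continuous f \o g}.
Proof.
move=> gAB /subspace_continuousP gc /subspace_continuousP fc.
apply/subspace_continuousP => x Ax; have Bgx : B (g x) by apply: gAB; exists x.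
move=> W /(fc _ Bgx) W1.
have : within A (nbhs x) (g @^-1` [set y | B y -> W (f y)]) by exact: gc.
rewrite /= /within /= => W2; rewrite !nbhs_simpl /= /within /=.
by apply: filterS W2 => y /= + Ay; apply => //; apply: gAB; exists y.
Qed.

Section arcs.
Context {R : realType} {E : normedModType R}.
Implicit Types (g : R -> E) (s t p q : R).

Lemma partition_step_le_length g s t r (i : nat) :
  itv_partition s t r -> (i < size r)%N ->
  (`|g (nth t (s :: r) i.+1) - g (nth t (s :: r) i)|%:E
     <= arc_length g s t)%E.
Proof.
move=> str ir; apply: (@le_trans _ _ (\sum_(0 <= i < size r)
    `|g (nth t (s :: r) i.+1) - g (nth t (s :: r) i)|)%:E); last first.
  by apply: ereal_sup_ubound; exists r.
rewrite lee_fin big_mkord (bigD1 (Ordinal ir)) //= lerDl.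
by apply: sumr_ge0.
Qed.

(** A chord is a step of a polygon with at most three edges. *)
Lemma chord_le_length g s t p q : s <= p -> p < q -> q <= t ->
  (`|g q - g p|%:E <= arc_length g s t)%E.
Proof.
rewrite le_eqVlt => /predU1P sp pq; rewrite le_eqVlt => /predU1P qt.
case: sp pq => [<-|sp] pq; case: qt => [<-|qt].
- apply: (@partition_step_le_length g s q [:: q] 0%N) => //.
  exact: itv_partition1.
- apply: (@partition_step_le_length g s t [:: q; t] 0%N) => //.
  by rewrite /itv_partition /= pq qt.
- apply: (@partition_step_le_length g s q [:: p; q] 1%N) => //.
  by rewrite /itv_partition /= sp pq.
- apply: (@partition_step_le_length g s t [:: p; q; t] 1%N) => //.
  by rewrite /itv_partition /= sp pq qt.
Qed.

Lemma arc_diam_le_length g s t : s <= t ->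
  (arc_diam g s t <= arc_length g s t)%E.
Proof.
move=> st.
have len0 : (0 <= arc_length g s t)%E.
  move: st; rewrite le_eqVlt => /predU1P[<-|st].
    apply: ereal_sup_ubound; exists [::]; last by rewrite big_nil.
    by rewrite /itv_partition /=.
  by apply: le_trans (chord_le_length g s t s t _ st _); rewrite ?lee_fin.
apply: ge_ereal_sup => _ [[_ _] /= [[p + <-] [q + <-]] <-].
rewrite /= !in_itv /= => /andP[sp pt] /andP[sq qt].
have [pq|qp|->] := ltgtP p q; last by rewrite subrr normr0.
- by rewrite distrC; exact: chord_le_length.
- exact: chord_le_length.
Qed.

Lemma dist_le_diam (A : set E) x y : A x -> A y -> (`|x - y|%:E <= diam A)%E.
Proof. by move=> Ax Ay; apply: ereal_sup_ubound; exists (x, y). Qed.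

Lemma dist_bdry_le (G : set E) x y : bdry G y -> (dist_bdry G x <= `|x - y|%:E)%E.
Proof. by move=> Gy; apply: ereal_inf_lbound; exists y. Qed.

Lemma length_john_diameter c (G : set E) :
  length_john c G -> diameter_john c G.
Proof.
move=> Gc x1 x2 Gx1 Gx2; have [a [b [g [ab gc gG gab len]]]] := Gc x1 x2 Gx1 Gx2.
exists a, b, g; split=> // t tab; apply: le_trans (len t tab).
move: tab; rewrite in_itv /= => /andP[at_ tb].
rewrite le_min !ge_min; apply/andP; split.
- by rewrite arc_diam_le_length.
- by rewrite [X in _ || X]arc_diam_le_length // orbT.
Qed.

End arcs.

Section quasisymmetric.
Context {R : realType} {E E' : normedModType R}.
Context (c M : R) (eta : R -> R) (G : set E) (f : E -> E').
Hypothesis etaM : forall r, 0 <= r <= c + 1 -> eta r <= M.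
Hypothesis finj : {in closure G &, injective f}.
Hypothesis fqs : quasisymmetric_rel eta (closure G) (bdry G) f.

Lemma quasisymmetric_rel_dist (w y z : E) :
  0 <= M -> bdry G w -> G y -> G z -> `|z - y| <= c * `|y - w| ->
  `|f z - f y| <= (1 + M) * `|f y - f w|.
Proof.
move=> M0 [Gw nGw] Gy Gz zyw.
have [->|zy] := eqVneq z y.
  by rewrite subrr normr0 mulr_ge0 ?addr_ge0.
have yw : y <> w by move=> yw; apply: nGw; rewrite -yw.
have zw : z <> w by move=> zw; apply: nGw; rewrite -zw.
have yw0 : 0 < `|y - w| by rewrite normr_gt0 subr_eq0; exact/eqP.
have fyw0 : 0 < `|f y - f w|.
  rewrite normr_gt0 subr_eq0; apply/eqP => /finj fyw.
  by apply: yw; apply: fyw; rewrite inE //; exact: subset_closure.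
have zwM : `|f z - f w| <= M * `|f y - f w|.
  rewrite -ler_pdivrMr //.
  apply: (le_trans (fqs w z y _)).
    split; [split=> //; exact: subset_closure|split=> //|left; split=> //].
    - by move=> /esym.
    - exact/eqP.
  apply: etaM; rewrite /ratio divr_ge0 //= ler_pdivrMr //.
  by have := ler_distD y z w; lra.
by have := ler_distD (f w) (f z) (f y); rewrite (distrC (f w)); lra.
Qed.

(** The factor [1 + M] bounds distances to [f y]; passing to the diameter
    through [f y] doubles it. *)
Lemma diam_image_le (G' : set E') (A : set E) (y : E) :
  0 < c -> 0 <= M -> bdry G' `<=` f @` bdry G -> A `<=` G -> A y ->
  (diam A <= c%:E * dist_bdry G y)%E ->
  (diam (f @` A) <= (2 * (1 + M))%:E * dist_bdry G' (f y))%E.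
Proof.
move=> c0 M0 bdryf AG Ay Ac; have M20 : 0 < 2 * (1 + M) by lra.
apply: ge_ereal_sup => _ [[_ _] /= [[z1 Az1 <-] [z2 Az2 <-]] <-].
rewrite -lee_pdivrMl //; apply: le_ereal_inf_tmp => _ [_ /bdryf[w Gw <-] <-].
have near z : A z -> `|f z - f y| <= (1 + M) * `|f y - f w|.
  move=> Az; apply: quasisymmetric_rel_dist => //; [exact: AG|exact: AG|].
  rewrite -lee_fin; apply: (le_trans (dist_le_diam _ _ _ Az Ay)).
  apply: (le_trans Ac); rewrite EFinM lee_pmul2l //; exact: dist_bdry_le.
rewrite lee_pdivrMl // lee_fin.
have := ler_distD (f y) (f z1) (f z2); rewrite (distrC (f y) (f z2)).
by have := near z1 Az1; have := near z2 Az2; lra.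
Qed.

Lemma diameter_john_quasisymmetric :
  0 < c -> 0 <= M -> {within closure G, continuous f} ->
  bdry (f @` G) `<=` f @` bdry G ->
  diameter_john c G -> diameter_john (2 * (1 + M)) (f @` G).
Proof.
move=> c0 M0 fc bdryf Gc _ _ [x1 Gx1 <-] [x2 Gx2 <-].
have [a [b [g [ab gc gG [ga gb] dia]]]] := Gc x1 x2 Gx1 Gx2.
exists a, b, (f \o g); split => //=.
- apply: (within_continuous_comp_sub _ _ _ _ (closure G)) gc fc.
  by apply: subset_trans gG _; exact: subset_closure.
- by rewrite -image_comp; exact: image_subset.
- by rewrite ga gb.
move=> t tab; move: (tab); rewrite in_itv /= => /andP[at_ tb].
have arc s u : a <= s -> s <= t -> t <= u -> u <= b ->
    (arc_diam g s u <= c%:E * dist_bdry G (g t))%E ->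
    (arc_diam (f \o g) s u
       <= (2 * (1 + M))%:E * dist_bdry (f @` G) (f (g t)))%E.
  move=> as_ st tu ub dgt; rewrite /arc_diam -image_comp.
  apply: diam_image_le dgt => //.
  - move=> _ [v + <-]; rewrite /= in_itv /= => /andP[sv vu]; apply: gG.
    by exists v => //=; rewrite in_itv /= (le_trans as_ sv) (le_trans vu ub).
  - by exists t => //=; rewrite in_itv /= st tu.
rewrite ge_min; have := dia t tab; rewrite ge_min.
by case/orP => /arc -> //; rewrite orbT.
Qed.

End quasisymmetric.

Lemma homeomorphism_bdry (T U : topologicalType) (G : set T) (G' : set U)
    (f : T -> U) :
  homeomorphism_on (closure G) (closure G') f -> f @` G = G' ->
  bdry G' `<=` f @` bdry G.
Proof.
move=> [[_ _ fsurj] _ _] fG w' [Gw' nGw']; have [w Gw fw] := fsurj _ Gw'.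
exists w => //; split=> // Gw0; apply: nGw'.
by rewrite -fG -fw; exists w.
Qed.

Theorem theorem1p11 (R : realType) (c : R) (eta : R -> R) :
  1 <= c ->
  homeomorphism_on (`[0, +oo[ : set R) (`[0, +oo[ : set R) eta ->
  exists2 c' : R, 1 <= c' &
    forall (E E' : completeNormedModType R) (G : set E) (G' : set E')
      (f : E -> E'),
    dim_ge2 E -> dim_ge2 E' ->
    proper_domain G -> proper_domain G' ->
    length_john c G ->
    homeomorphism_on (closure G) (closure G') f ->
    f @` G = G' ->
    quasisymmetric_rel eta (closure G) (bdry G) f ->
    diameter_john c' G'.
Proof.
move=> c1 [[etafun _ _] etac _].
have [||t0 t0c etaM] := @EVT_max R eta 0 (c + 1).
- lra.
- apply: continuous_subspaceW etac => r /=.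
  by rewrite !in_itv /= andbT => /andP[].
have M0 : 0 <= eta t0.
  have : `[0, +oo[%classic (eta t0).
    by apply: etafun; move: t0c; rewrite /= !in_itv /= andbT => /andP[].
  by rewrite /= in_itv /= andbT.
exists (2 * (1 + eta t0)); first lra.
move=> E E' G G' f _ _ _ _ Gc fhom fG fqs.
have bdryf := homeomorphism_bdry _ _ _ _ _ fhom fG.
have [[_ finj _] fc _] := fhom.
rewrite -fG in bdryf *; apply: (diameter_john_quasisymmetric c _ eta) => //.
- lra.
- exact: length_john_diameter.
Qed.
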